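(* Let $\mathfrak{F}$ be a subgroup-closed saturated superradical formation of finite groups containing all finite nilpotent groups, and let $G$ be a finite soluble group with $G\notin\mathfrak{F}$. Then the following statements are equivalent. (1) Every primary cyclic subgroup of $G$ is self-normalizing in $G$ or $\mathfrak{F}$-subnormal in $G$. (2) Every proper subgroup of $G$ is self-normalizing in $G$ or $\mathfrak{F}$-subnormal in $G$. (3) There are a prime $p$ dividing $|G|$ and an element $x\in G$ such that $G=G'\rtimes\langle x\rangle$, the subgroup $\langle x\rangle$ is both a Sylow $p$-subgroup of $G$ and a Carter subgroup of $G$, and $G'\rtimes\langle x^p\rangle\in\mathfrak{F}$.
   Context: All groups are finite. A formation is a class of finite groups closed under isomorphism, under quotients, and such that $G/M,G/N\in\mathfrak{F}$ with $M,N\lhd G$ implies $G/(M\cap N)\in\mathfrak{F}$. It is subgroup-closed if it contains every subgroup of each of its members, subnormal subgroup-closed if it contains every subnormal subgroup of each of its members, and saturated if $G/\Phi(G)\in\mathfrak{F}$ implies $G\in\mathfrak{F}$, where $\Phi(G)$ is the Frattini subgroup. A subgroup $H$ of a group $G$ is $\mathfrak{F}$-subnormal in $G$ if either $H=G$ or there is a chain of subgroups $H=H_0<H_1<\dots<H_n=G$ such that, for each $i\ge 1$, $H_{i-1}$ is a maximal subgroup of $H_i$ and $H_i/(H_{i-1})_{H_i}\in\mathfrak{F}$, where $A_B=\bigcap_{b\in B}A^b$ denotes the core of $A$ in $B$. A subnormal subgroup-closed formation $\mathfrak{F}$ is superradical if every group $G=AB$, where $A$ and $B$ are $\mathfrak{F}$-subnormal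 subgroups of $G$ belonging to $\mathfrak{F}$, belongs to $\mathfrak{F}$. A subgroup is primary if its order is a power of a prime. A subgroup $H$ of $G$ is self-normalizing if $N_G(H)=H$. A Carter subgroup is a nilpotent self-normalizing subgroup. $G'$ is the derived subgroup of $G$. $A\rtimes B$ denotes a semidirect product of a normal subgroup $A$ and a subgroup $B$. *)

(* Defs.v *)
From mathcomp Require Import all_boot all_fingroup all_solvable.

Set Implicit Arguments.
Unset Strict Implicit.
Unset Printing Implicit Defensive.

Local Open Scope group_scope.

Definition group_class := forall gT : finGroupType, {group gT} -> Prop.

Section Classes.

Variable F : group_class.

Definition isog_closed : Prop :=
  forall (gT rT : finGroupType) (G : {group gT}) (H : {group rT}),
    G \isog H -> F G -> F H.

Definition quotient_closed : Prop :=
  forall (gT : finGroupType) (G N : {group gT}),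
    N <| G -> F G -> F (G / N)%G.

Definition residually_closed : Prop :=
  forall (gT : finGroupType) (G M N : {group gT}),
    M <| G -> N <| G -> F (G / M)%G -> F (G / N)%G -> F (G / (M :&: N))%G.

Definition formation : Prop :=
  [/\ isog_closed, quotient_closed & residually_closed].

Definition subgroup_closed : Prop :=
  forall (gT : finGroupType) (G H : {group gT}), H \subset G -> F G -> F H.

Definition subnormal_closed : Prop :=
  forall (gT : finGroupType) (G H : {group gT}), H <|<| G -> F G -> F H.

Definition saturated : Prop :=
  forall (gT : finGroupType) (G : {group gT}), F (G / 'Phi(G))%G -> F G.

Definition contains_nilpotent : Prop :=
  forall (gT : finGroupType) (G : {group gT}), nilpotent G -> F G.

(* The chain is K 0 < K 1 < ... < K n, the values of K beyond n being         *)
(* irrelevant; the case H = G is n = 0.                                       *)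
Definition Fsubnormal (gT : finGroupType) (H G : {group gT}) : Prop :=
  exists (n : nat) (K : nat -> {group gT}),
    [/\ K 0 = H, K n = G
      & forall i : nat, i < n ->
          maximal (K i) (K i.+1)
          /\ F (K i.+1 / gcore (K i) (K i.+1))%G].

Definition superradical : Prop :=
  [/\ formation, subnormal_closed
    & forall (gT : finGroupType) (G A B : {group gT}),
        A * B = G -> Fsubnormal A G -> Fsubnormal B G -> F A -> F B -> F G].

End Classes.

Definition primary (gT : finGroupType) (H : {group gT}) : Prop :=
  exists p : nat, prime p /\ p.-group H.

Definition self_normalizing (gT : finGroupType) (H G : {group gT}) : Prop :=
  'N_G(H) = H.

Definition Carter (gT : finGroupType) (H G : {group gT}) : Prop :=
  [/\ H \subset G, nilpotent H & self_normalizing H G].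

(* Main.v *)
Require Import Defs.
From mathcomp Require Import all_boot all_fingroup all_solvable.

(** A soluble group [G] all of whose primary cyclic subgroups are F-subnormal
    lies in F: by induction a normal subgroup [A] of prime index [p] lies in F,
    and [G = A <y>] for any p-element [y] outside [A], so superradicality
    applies. Hence if [G] is not in F, statement (1) yields a self-normalizing
    cyclic p-subgroup [<x>]. It is a Sylow p-subgroup, being abelian it has a
    normal complement (Burnside), and the Frattini argument identifies the
    complement with [G']. The subgroup [G' <x^p>] contains no
    self-normalizing primary subgroup of [G], so all its primary cyclic
    subgroups are F-subnormal and it lies in F. Conversely, given (3), a
    subgroup of [G' <x^p>] is F-subnormal, and any other subgroup covers
    [G / G'], hence contains a conjugate of [<x>] and is self-normalizing by
    the Frattini argument. *)

Set Implicit Arguments.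
Unset Strict Implicit.
Unset Printing Implicit Defensive.

Local Open Scope group_scope.

(** * Permanence properties of F-subnormality *)

Section Fsubnormality.

Variables (F : group_class) (gT : finGroupType).
Implicit Types A B C D G H K M : {group gT}.

Lemma Fsubnormal_refl H : Fsubnormal F H H.
Proof. by exists 0, (fun=> H). Qed.

Lemma Fsubnormal_trans B A C :
  Fsubnormal F A B -> Fsubnormal F B C -> Fsubnormal F A C.
Proof.
move=> [n [K [K0 Kn stepK]]] [m [L [L0 Lm stepL]]].
exists (n + m), (fun i => if i < n then K i else L (i - n)); split.
- by case: ltnP => //; rewrite leqn0 => /eqP n0; rewrite sub0n L0 -Kn n0.
- by rewrite ltnNge leq_addr addKn.
move=> i lt_i; case: (ltnP i n) => [lt_in | le_ni].
  have [lt_i1n | ] := ltnP i.+1 n; first exact: stepK.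
  (* The step into the junction: its upper end is [L 0], which is [K n]. *)
  move=> le_ni1; have n_i1: n = i.+1 by apply/eqP; rewrite eqn_leq le_ni1.
  rewrite -n_i1 subnn L0 -Kn n_i1.
  by apply: stepK; rewrite n_i1.
rewrite ltnNge leqW //= subSn //.
by apply: stepL; rewrite ltn_subLR.
Qed.

Lemma Fsubnormal_maximal M G :
  maximal M G -> F (G / gcore M G)%G -> Fsubnormal F M G.
Proof.
move=> maxM FG; exists 1%N, (fun i => if i is 0 then M else G).
by split=> // [[|i]].
Qed.

Hypotheses (hform : formation F) (hsub : subgroup_closed F).

Lemma F_quotientS C D G :
  C <| G -> D <| G -> C \subset D -> F (G / C)%G -> F (G / D)%G.
Proof.
move=> nCG nDG sCD FGC; have [isoF quoF _] := hform.
apply: isoF (third_isog sCD nCG nDG) _.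
by apply: quoF FGC; apply: quotient_normal.
Qed.

Lemma F_quotient_setI C G H :
  C <| G -> H \subset G -> F (G / C)%G -> F (H / (C :&: H))%G.
Proof.
move=> /andP[_ nCG] sHG FGC; have [isoF _ _] := hform.
apply: (@isoF _ _ (H / C)%G).
  by rewrite isog_sym; apply: second_isog; apply: subset_trans nCG.
exact: hsub (quotientS C sHG) FGC.
Qed.

(** A maximal subgroup [M] of [B] above [A] has a core containing [C], so its factor is a quotient
    of [B / C]; induction on the order continues in [M], as [M / C] inherits F. *)
Lemma Fsubnormal_quotient C A B :
  C <| B -> C \subset A -> A \subset B -> F (B / C)%G -> Fsubnormal F A B.
Proof.
have [n] := ubnP #|B|; elim: n B => // n IHn B /ltnSE-leBn nCB sCA sAB FBC.
have [eqAB | [M maxM sAM]] := maximal_exists sAB.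
  by rewrite (val_inj eqAB); apply: Fsubnormal_refl.
have sMB := maxgroupp maxM; have ltMB := proper_card sMB.
have {}sMB := proper_sub sMB.
apply: (@Fsubnormal_trans M).
  apply: IHn => //; first exact: leq_trans ltMB leBn.
    exact: normalS (subset_trans sCA sAM) sMB nCB.
  exact: hsub (quotientS C sMB) FBC.
apply: Fsubnormal_maximal => //; apply: F_quotientS FBC => //.
  exact: gcore_normal.
by apply: gcore_max (normal_norm nCB); apply: subset_trans sAM.
Qed.

(** Intersecting a chain with [M] may destroy maximality, but each step still lies above a normal
    subgroup with quotient in F, so [Fsubnormal_quotient] refines it. *)
Lemma Fsubnormal_setI H G M : M \subset G ->
  Fsubnormal F H G -> Fsubnormal F (H :&: M) M.
Proof.
move=> sMG [n [K [K0 Kn stepK]]].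
have: Fsubnormal F (H :&: M) (K n :&: M); last first.
  by rewrite Kn (_ : (G :&: M)%G = M) //; apply/val_inj/setIidPr.
elim: n {Kn} stepK => [_|n IHn stepK].
  by rewrite K0; apply: Fsubnormal_refl.
apply: Fsubnormal_trans (IHn _) _ => [i lt_in|]; first exact/stepK/ltnW.
have [maxK FK] := stepK n (ltnSn n).
have sK := proper_sub (maxgroupp maxK).
have nCK := gcore_normal sK.
apply: (@Fsubnormal_quotient (gcore (K n) (K n.+1) :&: (K n.+1 :&: M))).
- by rewrite /= setIC; apply: normalGI nCK; apply: subsetIl.
- by rewrite /= setIA setSI // subIset // gcore_sub.
- exact: setSI.
exact: F_quotient_setI nCK (subsetIl _ _) FK.
Qed.

Lemma Fsubnormal_sub H G M : M \subset G -> H \subset M ->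
  Fsubnormal F H G -> Fsubnormal F H M.
Proof.
move=> sMG sHM /(Fsubnormal_setI sMG).
by rewrite (_ : (H :&: M)%G = H) //; apply/val_inj/setIidPl.
Qed.

Hypotheses (hsuper : superradical F) (hnil : contains_nilpotent F).

Lemma Fsubnormal_nilpotent_quotient A G :
  A <| G -> nilpotent (G / A) -> Fsubnormal F A G.
Proof.
move=> nAG nilGA; apply: (@Fsubnormal_quotient A); rewrite ?normal_sub //.
exact: hnil.
Qed.

Lemma F_sol_Fsubnormal_cyclic G : solvable G ->
    (forall H, H \subset G -> primary H -> cyclic H -> Fsubnormal F H G) ->
  F G.
Proof.
have [n] := ubnP #|G|; elim: n G => // n IHn G /ltnSE-leGn solG subH.
have [/eqP G1 | ntG] := boolP (G :==: 1).
  by apply: hnil; rewrite G1 nilpotent1.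
have [A maxA] := ex_maxnormal_ntrivg ntG.
have nAG := maxnormal_normal maxA; have sAG := normal_sub nAG.
have prAG := index_maxnormal_sol_prime solG maxA.
have FA: F A.
  apply: IHn; first exact: leq_trans (proper_card (maxnormal_proper maxA)) leGn.
    exact: solvableS solG.
  move=> H sHA primH cycH; apply: (Fsubnormal_sub sAG sHA).
  by apply: subH; first exact: subset_trans sAG.
set p := #|G : A| in prAG; have [P sylP] := Sylow_exists p G.
have [sPG pP _] := and3P sylP.
(* Otherwise [p], the index of [A], would divide the index of the Sylow subgroup [P]. *)
have /subsetPn[y Py notAy]: ~~ (P \subset A).
  apply/negP=> sPA; have: p^'.-nat #|G : P| by case/and3P: sylP.
  by rewrite -(Lagrange_index sAG sPA) pnatM -/p pnatE ?inE ?eqxx.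
have Gy := subsetP sPG y Py; have sYG: <[y]> \subset G by rewrite cycle_subG.
have primY: primary <[y]>.
  by exists p; split; last by apply: pgroupS pP; rewrite cycle_subG.
have [_ _ superF] := hsuper.
apply: (superF _ G A <[y]>%G) => //.
- apply: mulg_normal_maximal => //; first exact: p_index_maximal.
  by rewrite cycle_subG.
- apply: Fsubnormal_nilpotent_quotient => //.
  apply/abelian_nil/cyclic_abelian/prime_cyclic.
  by rewrite card_quotient ?normal_norm.
- by apply: subH => //; apply: cycle_cyclic.
by apply/hnil/abelian_nil/cycle_abelian.
Qed.

End Fsubnormality.

(** Climb the derived series of [D]: if its term [n.+1] lies in the Fitting subgroup, [D]
    centralises it, so term [n] is abelian modulo its centre, hence nilpotent and normal in [G]. *)
Lemma sol_cent_sub_Fitting (gT : finGroupType) (G : {group gT}) :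
  solvable G -> 'C_G('F(G)) \subset 'F(G).
Proof.
move=> solG; set D := 'C_G('F(G)).
have nDG: D <| G.
  by rewrite /normal subsetIl normsI ?normG ?norms_cent ?gFnorm.
have /derivedP[n Dn1]: solvable D by apply: solvableS solG; apply: subsetIl.
have: D^`(n) \subset 'F(G) by rewrite Dn1 sub1G.
elim: n {Dn1} => [|n IHn] sDF; first by [].
apply/IHn/Fitting_max; first exact: gFnormal_trans.
rewrite -quotient_center_nil; apply/abelian_nil/sub_der1_abelian.
rewrite subsetI der_sub (subset_trans sDF) // centsC.
by rewrite (subset_trans (der_sub n D)) // subsetIr.
Qed.

(** * Self-normalizing Sylow subgroups and normal complements *)

Section SelfNormalizing.

Variables (gT : finGroupType) (p : nat).
Implicit Types G H P : {group gT}.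

(** Normalizers grow in the p-group [Q]. *)
Lemma self_normalizing_Sylow G P :
  P \subset G -> p.-group P -> self_normalizing P G -> p.-Sylow(G) P.
Proof.
move=> sPG pP nP; have [Q sylQ sPQ] := Sylow_superset sPG pP.
have [sQG pQ _] := and3P sylQ.
suffices <-: Q :=: P by [].
apply: nilpotent_sub_norm (pgroup_nil pQ) sPQ _.
by apply: subset_trans (setSI _ sQG) _; rewrite nP.
Qed.

(** Frattini argument for [H] normal in ['N_G(H)]: the normalizer of [P] contributes only [P]. *)
Lemma self_normalizing_over_Sylow G H P :
    p.-Sylow(G) P -> self_normalizing P G -> P \subset H -> H \subset G ->
  self_normalizing H G.
Proof.
move=> sylP nP sPH sHG; apply/eqP; rewrite eqEsubset subsetI sHG normG !andbT.
rewrite -(Frattini_arg (normalSG sHG) (pHall_subl sPH sHG sylP)).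
rewrite mul_subG // (subset_trans _ sPH) //.
by apply: subset_trans (setSI _ (subsetIl _ _)) _; rewrite nP.
Qed.

(** Frattini argument for the join of [G^](1)[and]P[, normal because it contains]G^[(1)]. *)
Lemma der1_mul_Sylow G P :
  p.-Sylow(G) P -> self_normalizing P G -> G^`(1) * P = G.
Proof.
move=> sylP nP; have sPG := pHall_sub sylP.
have sDG := der_sub 1 G.
have sDPG: G^`(1) <*> P \subset G by rewrite join_subG sDG.
have nDPG: G^`(1) <*> P <| G by rewrite sub_der1_normal ?joing_subl.
have nDP: P \subset 'N(G^`(1)) := subset_trans sPG (der_norm 1 G).
have := Frattini_arg nDPG (pHall_subl (joing_subr _ _) sDPG sylP).
by rewrite nP /= norm_joinEr // -mulgA mulGid.
Qed.

(* Burnside's theorem needs no transfer here: [C(F(G)) <= F(G)] applied to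
   [G / O_p^'(G)] shows that [P] becomes normal there. *)
Lemma sol_abelian_Sylow_sdprod G P :
    solvable G -> p.-Sylow(G) P -> abelian P -> self_normalizing P G ->
  'O_p^'(G) ><| P = G.
Proof.
move=> solG sylP cPP nP; have [sPG pP _] := and3P sylP.
set O := ('O_p^'(G))%G; have nOG: O <| G := pcore_normal _ _.
have nOP: P \subset 'N(O) := subset_trans sPG (normal_norm nOG).
have tiOP: O :&: P = 1.
  by rewrite coprime_TIg // coprime_sym (pnat_coprime pP (pcore_pgroup _ _)).
have sylPb: p.-Sylow(G / O) (P / O) by apply: quotient_pHall.
(* The Fitting subgroup is a p-group, since [G / O] has trivial p'-core. *)
have FE: 'F(G / O) = 'O_p('F(G / O)).
  have /dprodP[_ defF _ _] := nilpotent_pcoreC p (Fitting_nil (G / O)).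
  suffices O1: 'O_p^'('F(G / O)) = 1 by move: defF; rewrite O1 mulg1 => ->.
  apply/trivgP; rewrite -(trivg_pcore_quotient p^' G) -/O.
  apply: pcore_max; first exact: pcore_pgroup.
  by apply: gFnormal_trans; apply: Fitting_normal.
have sFP: 'F(G / O) \subset P / O.
  apply: subset_trans (pcore_sub_Hall sylPb); rewrite FE.
  apply: pcore_max; first exact: pcore_pgroup.
  by apply: gFnormal_trans; apply: Fitting_normal.
(* The abelian group [P / O] centralises the Fitting subgroup, which it contains. *)
have sPF: P / O \subset 'F(G / O).
  apply: subset_trans (sol_cent_sub_Fitting (quotient_sol O solG)).
  rewrite subsetI quotientS //=; apply: subset_trans (centS sFP).
  exact: quotient_abelian.
have nPb: P / O <| G / O.
  have ->: P / O = 'F(G / O) by apply/eqP; rewrite eqEsubset sPF.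
  exact: Fitting_normal.
have nOPG: O <*> P <| G.
  rewrite norm_joinEr // -quotientK // -(quotientGK nOG).
  by rewrite cosetpre_normal.
have sOPG := normal_sub nOPG.
have := Frattini_arg nOPG (pHall_subl (joing_subr _ _) sOPG sylP).
rewrite nP /= norm_joinEr // -mulgA mulGid => defG.
by rewrite sdprodE.
Qed.

Lemma sol_abelian_Sylow_der1_sdprod G P :
    solvable G -> p.-Sylow(G) P -> abelian P -> self_normalizing P G ->
  G^`(1) ><| P = G.
Proof.
move=> solG sylP cPP nP.
have defG := sol_abelian_Sylow_sdprod solG sylP cPP nP.
suffices ->: G^`(1) = 'O_p^'(G) by [].
have [nOG sPG mulOP _ tiOP] := sdprod_context defG.
have sDO: G^`(1) \subset 'O_p^'(G).
  apply: der1_min (normal_norm nOG) _.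
  suffices: abelian ('O_p^'(G) * P / 'O_p^'(G)) by rewrite mulOP.
  by rewrite quotientMidl quotient_abelian.
(* Dedekind's law inside the p'-core, which meets [P] trivially. *)
have := group_modl P sDO; rewrite (der1_mul_Sylow sylP nP) (setIC P) tiOP mulg1.
by rewrite (setIidPr (normal_sub nOG)).
Qed.

Lemma self_normalizing_conj G H x :
  x \in G -> self_normalizing H G -> self_normalizing (H :^ x) G.
Proof.
by move=> Gx nH; rewrite /self_normalizing /= normJ -{1}(conjGid Gx) -conjIg nH.
Qed.

(** By order, a Sylow p-subgroup of [H] is Sylow in [G], hence conjugate to [P]. *)
Lemma self_normalizing_card_dvd_Sylow G H P :
    p.-Sylow(G) P -> self_normalizing P G -> H \subset G -> #|P| %| #|H| ->
  self_normalizing H G.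
Proof.
move=> sylP nP sHG dvPH; have [Q sylQ] := Sylow_exists p H.
have [sQH pQ _] := and3P sylQ; have [_ pP _] := and3P sylP.
have sylQG: p.-Sylow(G) Q.
  rewrite pHallE (subset_trans sQH) // (card_Hall sylQ) eqn_dvd.
  rewrite partn_dvd ?cardSg ?cardG_gt0 //= -(card_Hall sylP).
  by rewrite -(part_pnat_id pP) partn_dvd.
have [x Gx defQ] := Sylow_trans sylP sylQG.
apply: self_normalizing_over_Sylow sylQG _ sQH sHG.
by rewrite (val_inj defQ : Q = (P :^ x)%G); apply: self_normalizing_conj.
Qed.

End SelfNormalizing.

Lemma der1_sdprod_dvd (gT : finGroupType) (G H P : {group gT}) :
  G^`(1) ><| P = G -> G^`(1) * H = G -> #|P| %| #|H|.
Proof.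
move=> /sdprod_card cardG mulG.
rewrite -(dvdn_pmul2l (cardG_gt0 G^`(1))) cardG mul_cardG mulG.
exact: dvdn_mulr.
Qed.

(** In a cyclic p-group, a power [x ^+ m] with [m] prime to [p] is again a generator. *)
Lemma cycle_expg_prime_max (gT : finGroupType) (p : nat) (x : gT)
    (H : {group gT}) :
    prime p -> p.-elt x -> H \subset <[x]> -> x \notin H ->
  H \subset <[x ^+ p]>.
Proof.
move=> prp px sHx; have /cyclicP[y defH] := cyclicS sHx (cycle_cyclic x).
have /cycleP[m def_y]: y \in <[x]> by rewrite -cycle_subG -defH.
rewrite defH def_y cycle_subG; have [/dvdnP[k ->] _ | p'm] := boolP (p %| m).
  by rewrite mulnC expgM mem_cycle.
case/negP; have: generator <[x]> (x ^+ m).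
  by rewrite generator_coprime (pnat_coprime px) // p'natE.
by move/eqP <-; apply: cycle_id.
Qed.

(** * The equivalence, proved as (2) to (1), (3) to (2) and (1) to (3) *)

Theorem mainTheorem1 (F : group_class)
    (hform : formation F) (hsub : subgroup_closed F) (hsat : saturated F)
    (hsuper : superradical F) (hnil : contains_nilpotent F)
    (gT : finGroupType) (G : {group gT}) (hsol : solvable G) (hG : ~ F gT G) :
  let S1 := forall H : {group gT}, H \subset G -> primary H -> cyclic H ->
              self_normalizing H G \/ Fsubnormal F H G in
  let S2 := forall H : {group gT}, H \proper G ->
              self_normalizing H G \/ Fsubnormal F H G in
  let S3 := exists (p : nat) (x : gT),
              [/\ prime p, p %| #|G| & x \in G] /\
              [/\ G^`(1) ><| <[x]> = G,
                  p.-Sylow(G) <[x]>,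
                  Carter <[x]>%G G
                & exists K : {group gT}, G^`(1) ><| <[x ^+ p]> = K /\ F gT K] in
  (S1 <-> S2) /\ (S2 <-> S3).
Proof.
move=> S1 S2 S3.
have S2_1: S2 -> S1.
  move=> s2 H sHG _ _; have [defH | ltHG] := eqVproper sHG; last exact: s2.
  by rewrite (val_inj defH); right; apply: Fsubnormal_refl.
suffices [S1_3 S3_2]: (S1 -> S3) /\ (S3 -> S2).
  by split; split=> [s1 | s2]; auto.
split=> [s1 | [p [x [[prp _ Gx] [defG sylx [_ _ nx] [K [defK FK]]]]]]];
    last first.
  move=> H ltHG; have [nDG _ mulDX nDX tiDX] := sdprod_context defG.
  have [_ _ mulDXp _ _] := sdprod_context defK.
  have sHG := proper_sub ltHG.
  have sDK: G^`(1) \subset K by rewrite -mulDXp mulG_subl.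
  have sKG: K \subset G.
    by rewrite -mulDXp mul_subG ?der_sub // cycle_subG groupX.
  have [sHK | notsHK] := boolP (H \subset K).
    (* [H] is F-subnormal in [K] because [K] is in F, and [K] in [G] because [G / K] is abelian. *)
    right; apply: (@Fsubnormal_trans _ _ K).
      apply: (@Fsubnormal_quotient _ _ _ _ 1) => //; rewrite ?normal1 ?sub1G //.
      by have [_ quoF _] := hform; apply: quoF; rewrite ?normal1.
    apply: Fsubnormal_nilpotent_quotient => //; first exact: sub_der1_normal.
    exact/abelian_nil/sub_der1_abelian.
  left; apply: (self_normalizing_card_dvd_Sylow sylx nx sHG).
  apply: (der1_sdprod_dvd defG).
  have nDH: H \subset 'N(G^`(1)) := subset_trans sHG (normal_norm nDG).
  rewrite -norm_joinEr //; apply/eqP.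
  rewrite eqEsubset join_subG der_sub sHG /=.
  rewrite -{1}mulDX mul_subG ?joing_subl // cycle_subG.
  apply: contraR notsHK => notLx.
  apply: subset_trans (joing_subr G^`(1) H) _.
  have sLG: G^`(1) <*> H \subset G by rewrite join_subG der_sub.
  have := group_modl <[x]> (joing_subl G^`(1) H).
  rewrite mulDX (setIidPr sLG) => <-; rewrite -mulDXp mulgS //.
  apply: (@cycle_expg_prime_max _ _ _ (_ :&: _)) => //.
  - by case/and3P: sylx.
  - exact: subsetIl.
  by rewrite inE negb_and notLx orbT.
have [x [Gx prx px nx]]: exists x, [/\ x \in G, prime (pdiv #[x]),
    (pdiv #[x]).-elt x & self_normalizing <[x]> G].
  (* Reading the prime off as [pdiv #[x]] makes the condition boolean, so the case split is
     decidable. *)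
  have [/exists_inP[x Gx /andP[px /eqP nx]] | noX] :=
    boolP [exists x in G, (pdiv #[x]).-elt x && ('N_G(<[x]>) == <[x]>)].
    exists x; split=> //; apply: pdiv_prime; rewrite order_gt1.
    (* For [x = 1], self-normalization would force [G] to be trivial. *)
    apply: contra_notN hG => /eqP x1; apply: hnil.
    by move: nx; rewrite x1 cycle1 norm1 setIT => ->; apply: nilpotent1.
  case: hG; apply: F_sol_Fsubnormal_cyclic => // H sHG primH cycH.
  have [nH|//] := s1 H sHG primH cycH; case/negP: noX.
  have [[q [prq qH]] /cyclicP[x defH]] := (primH, cycH).
  have Gx: x \in G by rewrite -cycle_subG -defH.
  apply/exists_inP; exists x; rewrite // -defH nH eqxx andbT.
  have /p_natP[k ox]: q.-nat #[x] by rewrite /order -defH.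
  rewrite /p_elt ox; case: k {ox} => // k.
  by rewrite pdiv_pfactor // pnatX pnat_id.
set p := pdiv #[x] in prx px.
have sXG: <[x]> \subset G by rewrite cycle_subG.
have sylX: p.-Sylow(G) <[x]> by apply: self_normalizing_Sylow.
have defG := sol_abelian_Sylow_der1_sdprod hsol sylX (cycle_abelian x) nx.
have [nDG _ mulDX nDX tiDX] := sdprod_context defG.
have sXpX: <[x ^+ p]> \subset <[x]> by apply: cycleX.
have defM: G^`(1) ><| <[x ^+ p]> = G^`(1) <*> <[x ^+ p]>.
  rewrite sdprodEY ?(subset_trans sXpX) //.
  by apply/trivgP; rewrite -tiDX setIS.
have sMG: G^`(1) <*> <[x ^+ p]> \subset G.
  by rewrite join_subG der_sub (subset_trans sXpX).
exists p, x; split; first by rewrite (dvdn_trans (pdiv_dvd _)) ?order_dvdG.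
split=> //; first by split=> //; apply/abelian_nil/cycle_abelian.
exists (G^`(1) <*> <[x ^+ p]>)%G; split; first exact: defM.
apply: F_sol_Fsubnormal_cyclic => // [|H sHM [q [prq qH]] cycH].
  exact: solvableS sMG hsol.
have sHG := subset_trans sHM sMG.
case: (s1 H sHG) => // [|nH|]; [by exists q | | exact: Fsubnormal_sub].
(* A self-normalizing [H] of any prime [q] would cover
   [G / G^](1)[, so]#[x][would divide the order of]H[and of the group containing it;]G^[(1)] being a
   p'-group, [#[x]] would divide the smaller [#[x ^+ p]]. *)
have sylH := self_normalizing_Sylow sHG qH nH.
have dvXH := der1_sdprod_dvd defG (der1_mul_Sylow sylH nH).
have D_p': p^'.-group G^`(1).
  case/and3P: sylX => _ _; rewrite -divgS // -(sdprod_card defG).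
  by rewrite mulnK ?cardG_gt0.
have: #[x] %| #[x ^+ p].
  rewrite -(@Gauss_dvdr _ #|G^`(1)|) ?(pnat_coprime px) //.
  by rewrite [(_ * _)%N](sdprod_card defM) (dvdn_trans dvXH) ?cardSg.
rewrite orderXdiv ?pdiv_dvd // => /dvdn_leq.
rewrite divn_gt0 ?prime_gt0 // pdiv_leq // leqNgt ltn_Pdiv ?prime_gt1 //.
by move/(_ isT).
Qed.
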